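(* Let $n\ge 1$, let $c_1,\dots,c_n$ be positive integers (thresholds), let $p\in[0,1]$, and suppose that all $n$ areas have the same initial acceptance probability $p_1=\dots=p_n=p$. Let $\pi$ be an arbitrary non-adaptive spreading strategy (a permutation of the $n$ areas) in the full propagation setting. If $p\ge \frac12$, then the expected number of adopters under $\pi$ is at least $np$. If $p\le\frac12$, then the expected number of adopters under $\pi$ is at most $np$.
   Context: Full propagation setting. There are $n$ areas $1,\dots,n$. Area $v$ has a threshold $c_v\in\mathbb{Z}_{>0}$ and an initial acceptance probability $p_v\in[0,1]$. A non-adaptive spreading strategy is a permutation $\pi$ of the areas fixed in advance; $\pi(t)$ is the area scheduled at time $t$, $t=1,\dots,n$. When area $v=\pi(t)$ is scheduled, it makes an irrevocable decision $X_v\in\{1,-1\}$ ($1$ = accept, $-1$ = reject) as follows. Let $I_{t-1}=\sum_{s<t}X_{\pi(s)}$ be the number of acceptances minus the number of rejections among all previously scheduled areas (so $I_0=0$). If $I_{t-1}\ge c_v$ then $X_v=1$; if $I_{t-1}\le -c_v$ then $X_v=-1$; if $|I_{t-1}|<c_v$ then, using randomness independent of everything before, $X_v=1$ with probability $p_v$ and $X_v=-1$ with probability $1-p_v$. The number of adopters is the number of areas $v$ with $X_v=1$. *)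

(* Defs.v *)
From mathcomp Require Import all_boot all_order all_algebra all_fingroup.

Set Implicit Arguments.
Unset Strict Implicit.
Unset Printing Implicit Defensive.

Import Order.TTheory GRing.Theory Num.Theory.
Local Open Scope ring_scope.

Section FullPropagation.

Variables (R : realFieldType) (n : nat).

(* Areas are 'I_n, thresholds are c : 'I_n -> nat (positivity is a hypothesis
   of the theorem) and initial acceptance probabilities are p : 'I_n -> R.
   A non-adaptive strategy is a permutation pi : 'S_n, with times numbered from
   0: the area scheduled at time t : 'I_n is pi t.  An outcome of the process
   is the vector x of all decisions, x v = true meaning that v accepts. *)
Implicit Types (c : 'I_n -> nat) (p : 'I_n -> R) (pi : 'S_n).
Implicit Types (x : {ffun 'I_n -> bool}) (v t : 'I_n).

Definition decision_value (b : bool) : int := if b then 1 else -1.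

(* I = acceptances minus rejections among the areas scheduled strictly
   before time t. *)
Definition influence pi x t : int :=
  \sum_(s < n | (s < t)%N) decision_value (x (pi s)).

(* Conditional probability that v accepts when scheduled, given the current
   value I of the influence. *)
Definition accept_prob c p v (I : int) : R :=
  if (c v)%:Z <= I then 1
  else if I <= - (c v)%:Z then 0
  else p v.

Definition decision_prob c p pi x t : R :=
  let a := accept_prob c p (pi t) (influence pi x t) in
  if x (pi t) then a else 1 - a.

(* Law of the decision vector, by the chain rule: since each coin is
   independent of the past, the conditional probability of the decision taken
   at time t given all earlier decisions is decision_prob c p pi x t. *)
Definition outcome_prob c p pi x : R := \prod_(t < n) decision_prob c p pi x t.

Definition adopters x : nat := #|[set v | x v]|.

Definition expected_adopters c p pi : R :=
  \sum_(x : {ffun 'I_n -> bool}) outcome_prob c p pi x * (adopters x)%:R.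

End FullPropagation.

(* Main.v *)
Require Import Defs.
From mathcomp Require Import all_boot all_order all_algebra all_fingroup.
From mathcomp Require Import zify ring lra.

(** Let [I] be the influence before time [t], and put [F k = P (I >= k)],
    [G k = P (I <= -k)].  An area with threshold [c] accepts with probability
    [F c + p (1 - F c - G c) = p + ((1 - p) F c - p G c)], so for [p >= 1/2] it
    suffices that [p G k <= (1 - p) F k] for all [k >= 1].  This tail inequality
    is preserved by every step of the process, whatever the threshold of the
    area scheduled (its pointwise analogue for [P (I = k)] and [P (I = -k)] is
    not).  The case [p <= 1/2] follows by exchanging acceptance and rejection. *)

Set Implicit Arguments.
Unset Strict Implicit.
Unset Printing Implicit Defensive.

Import Order.TTheory GRing.Theory Num.Theory.
Local Open Scope ring_scope.

(* [F] is a tail [k |-> P (I >= k)], and the result its value at [j.+1] after a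
   step up with probability [a], down with probability [b], where the decision
   is forced once [|I| >= c]. *)
Definition tail_step (R : realFieldType) (a b : R) (c : nat) (F : nat -> R)
    (j : nat) : R :=
  if (j < c)%N then b * F (if (j.+1 < c)%N then j.+2 else j.+1) + a * F j
  else F j.

(** A rearrangement argument: for [0 < j < c], add [a] times the hypothesis at [j] to [b] times the
    one at the shifted index [m]. The surplus over the goal is [a * (a - b) * (G j - G m)],
    nonnegative since [b <= a] and [G] decreases. *)
Lemma tail_step_dominance (R : realFieldType) (a b : R) (c : nat)
    (F G : nat -> R) :
    0 <= b -> b <= a -> (0 < c)%N ->
    (forall k, G k.+1 <= G k) -> F 0 + G 1 = G 0 + F 1 ->
    (forall k, a * G k.+1 <= b * F k.+1) ->
  forall j, a * tail_step b a c G j <= b * tail_step a b c F j.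
Proof.
move=> b0 ba c0 G_anti FG01 domFG j; rewrite /tail_step.
case: ifPn => jc; last first.
  by case: j jc => [|j] jc; [rewrite c0 in jc | exact: domFG].
set m := if _ then _ else _.
have Gm : G m <= G j.+1 by rewrite /m; case: ifP => _ //; exact: G_anti.
have dm : a * G m <= b * F m by rewrite /m; case: ifP => _; exact: domFG.
have a0 : 0 <= a by exact: le_trans ba.
have ab0 : 0 <= a * (a - b) by rewrite mulr_ge0 ?subr_ge0.
have dm' := ler_wpM2l b0 dm.
(* Dominance is not assumed at index 0; there [FG01] trades [F 0 - G 0] for [F 1 - G 1], and the
   same argument runs at index 1. *)
case: j jc @m Gm dm dm' => [|j] jc m Gm dm dm'.
  have d1 := ler_wpM2l a0 (domFG 0).
  have := ler_wpM2l ab0 Gm.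
  have -> : F 0 = G 0 + F 1 - G 1 by rewrite -FG01; ring.
  nra.
have d1 := ler_wpM2l a0 (domFG j).
have := ler_wpM2l ab0 (le_trans Gm (G_anti j.+1)).
nra.
Qed.

(** * The process stopped at time [m], on a common sample space *)

Section Process.

Variables (R : realFieldType) (n : nat) (c : 'I_n -> nat) (q : 'I_n -> R).
Variables (p : R) (pi : 'S_n).
Hypothesis hc : forall v, (0 < c v)%N.
Hypothesis hq : forall v, q v = p.
Hypothesis hp : 0 <= p <= 1.

Implicit Types (x : {ffun 'I_n -> bool}) (t : 'I_n) (b : bool).
Implicit Types (f g : {ffun 'I_n -> bool} -> R).

Definition update t b x : {ffun 'I_n -> bool} :=
  [ffun v => if v == pi t then b else x v].

Definition influence_at (m : nat) x : int :=
  \sum_(s < n | (s < m)%N) decision_value (x (pi s)).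

Definition accept_at t x : R := accept_prob c q (pi t) (influence_at t x).

(* Decisions follow the process before time [m] and are fair coins from [m] on,
   so that all times share the sample space of complete outcomes. *)
Definition weight (m : nat) x : R :=
  \prod_(t < n) (if (t < m)%N then decision_prob c q pi x t else 2%:R^-1).

Definition expect (m : nat) f : R := \sum_x weight m x * f x.

Definition upper_tail (m k : nat) : R :=
  expect m (fun x => (k%:Z <= influence_at m x)%R%:R).

Definition lower_tail (m k : nat) : R :=
  expect m (fun x => (influence_at m x <= - k%:Z)%R%:R).

Lemma updateE t b x s :
  update t b x (pi s) = if s == t then b else x (pi s).
Proof. by rewrite ffunE (inj_eq perm_inj). Qed.

Lemma sum_update t f :
  \sum_x f x = \sum_x (f (update t true x) + f (update t false x)) / 2%:R.
Proof.
(* Each outcome is paired with the one differing only in the decision of [pi t]. *)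
pose flip x := update t (~~ x (pi t)) x.
have flipK : involutive flip.
  move=> x; apply/ffunP => v; rewrite !ffunE eqxx.
  by case: eqP => [->|//]; rewrite negbK.
have -> : \sum_x f x = \sum_x (f x + f (flip x)) / 2%:R.
  rewrite -mulr_suml big_split /=.
  rewrite -(reindex_inj (inv_inj flipK) (F := f) (P := xpredT)) /=.
  by field.
apply: eq_bigr => x _; congr (_ / _); rewrite /flip.
have xE : update t (x (pi t)) x = x.
  by apply/ffunP => v; rewrite ffunE; case: eqP => [->|].
by case: (x (pi t)) xE => /= {1}<- //; rewrite addrC.
Qed.

Lemma influence_at_update m t b x :
  (m <= t)%N -> influence_at m (update t b x) = influence_at m x.
Proof.
move=> mt; apply: eq_bigr => s sm; rewrite updateE.
by case: eqP => [st|//]; rewrite st ltnNge mt in sm.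
Qed.

Lemma influence_atS t x :
  influence_at t.+1 x = influence_at t x + decision_value (x (pi t)).
Proof.
rewrite /influence_at (bigD1 t) //= addrC; congr (_ + _).
by apply: eq_bigl => s; rewrite ltnS [RHS]ltn_neqAle andbC.
Qed.

(** The decision of [pi t] affects no other factor of the weight: earlier decisions do not see it
    and later ones are coins. The coin factor at time [t] absorbs the one half from [sum_update]. *)
Lemma expect_step t f :
  expect t.+1 f = expect t (fun x =>
    accept_at t x * f (update t true x)
    + (1 - accept_at t x) * f (update t false x)).
Proof.
pose rest x := \prod_(s < n | s != t)
  (if (s < t)%N then decision_prob c q pi x s else 2%:R^-1).
have rest_update b x : rest (update t b x) = rest x.
  apply: eq_bigr => s st; case: ifP => // lt_st.
  rewrite /decision_prob updateE (negbTE st).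
  by rewrite -![influence pi _ s]/(influence_at s _) (influence_at_update _ _ (ltnW lt_st)).
have weight_t x : weight t x = 2%:R^-1 * rest x.
  by rewrite /weight (bigD1 t) //= ltnn.
have weight_tS x : weight t.+1 x = decision_prob c q pi x t * rest x.
  rewrite /weight (bigD1 t) //= ltnSn; congr (_ * _).
  apply: eq_bigr => s st; rewrite ltnS leq_eqVlt.
  by rewrite (inj_eq val_inj) (negbTE st).
rewrite /expect (sum_update t); apply: eq_bigr => x _.
rewrite !weight_tS weight_t !rest_update /decision_prob !updateE eqxx.
rewrite -![influence pi _ t]/(influence_at t _) !influence_at_update // -/(accept_at t x).
by ring.
Qed.

(** * Expectations and linearity over the areas *)

Lemma eq_expect m f g : f =1 g -> expect m f = expect m g.
Proof. by move=> fg; apply: eq_bigr => x _; rewrite fg. Qed.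

Lemma expectD m f g :
  expect m (fun x => f x + g x) = expect m f + expect m g.
Proof. by rewrite -big_split; apply: eq_bigr => x _; rewrite mulrDr. Qed.

Lemma expectZ m a f : expect m (fun x => a * f x) = a * expect m f.
Proof. by rewrite mulr_sumr; apply: eq_bigr => x _; rewrite mulrCA. Qed.

Lemma le_expect m f g :
  (forall x, f x <= g x) -> expect m f <= expect m g.
Proof.
case/andP: hp => p0 p1 fg; apply: ler_sum => x _; apply: ler_wpM2l => //.
apply: prodr_ge0 => t _; case: ifP => _; last by rewrite invr_ge0 ler0n.
rewrite /decision_prob /accept_prob hq.
by do ?case: ifP => _; rewrite ?subr_ge0 ?ler01.
Qed.

Lemma expect1 m : (m <= n)%N -> expect m (fun=> 1) = 1.
Proof.
elim: m => [_|m IHm lt_mn].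
  rewrite /expect (eq_bigr (fun=> 2%:R ^- n)) => [|x _].
    rewrite sumr_const card_ffun card_bool card_ord -(mulr_natl (2%:R ^- n)) natrX.
    by rewrite divff // expf_neq0 // pnatr_eq0.
  by rewrite mulr1 /weight prodr_const card_ord exprVn.
rewrite (expect_step (Ordinal lt_mn)) -[RHS](IHm (ltnW lt_mn)).
by apply: eq_expect => x; ring.
Qed.

(** Steps after [t] leave [x (pi t)] alone, so they integrate out down to [m = t.+1]. *)
Lemma expect_accepts t m : (t < m <= n)%N ->
  expect m (fun x => (x (pi t))%:R) = expect t (accept_at t).
Proof.
elim: m => // m IHm /andP[]; rewrite ltnS leq_eqVlt => tm lt_mn.
rewrite (expect_step (Ordinal lt_mn)).
case/orP: tm => [/eqP tm|tm].
  have -> : Ordinal lt_mn = t by exact: val_inj.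
  by apply: eq_expect => x; rewrite !updateE eqxx /=; ring.
rewrite -IHm ?tm ?(ltnW lt_mn) //; apply: eq_expect => x; rewrite !updateE.
have -> : (t == Ordinal lt_mn) = false by rewrite -val_eqE /= ltn_eqF.
by ring.
Qed.

Lemma expected_adoptersE :
  expected_adopters c q pi = \sum_(t < n) expect t (accept_at t).
Proof.
transitivity (\sum_(t < n) expect n (fun x => (x (pi t))%:R)); last first.
  by apply: eq_bigr => t _; rewrite expect_accepts // ltn_ord leqnn.
rewrite exchange_big; apply: eq_bigr => x _; rewrite -mulr_sumr.
congr (_ * _).
  by apply: eq_bigr => t _; rewrite ltn_ord.
rewrite /adopters -sum1dep_card natr_sum big_mkcond (reindex_inj (@perm_inj _ pi)).
by apply: eq_bigr => t _; case: (x _).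
Qed.

(** * Recurrences for the tails *)

Ltac case_le := match goal with
  |- context [(?a <= ?b)%R] => case: (boolP (a <= b)%R) => ?
end.

Lemma upper_tail_step t j :
  upper_tail t.+1 j.+1 = tail_step p (1 - p) (c (pi t)) (upper_tail t) j.
Proof.
rewrite /upper_tail /tail_step expect_step.
(* The identity holds for each value of the influence. At [j.+1 = c] the value [j.+1] is already
   forced upwards, hence [F j.+1] instead of [F j.+2]. *)
case: (ltnP j.+1) => jc; case: ltnP => jc'; rewrite -?expectZ -?expectD;
  apply: eq_expect => x;
  rewrite !influence_atS !influence_at_update // !updateE eqxx /accept_at;
  rewrite /accept_prob hq /decision_value; move: (influence_at t x) => I;
  move: (c (pi t)) (hc (pi t)) jc jc' => C C0 jc jc';
  do !case_le; solve [exfalso; lia | rewrite /=; ring].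
Qed.

Lemma lower_tail_step t j :
  lower_tail t.+1 j.+1 = tail_step (1 - p) p (c (pi t)) (lower_tail t) j.
Proof.
rewrite /lower_tail /tail_step expect_step.
case: (ltnP j.+1) => jc; case: ltnP => jc'; rewrite -?expectZ -?expectD;
  apply: eq_expect => x;
  rewrite !influence_atS !influence_at_update // !updateE eqxx /accept_at;
  rewrite /accept_prob hq /decision_value; move: (influence_at t x) => I;
  move: (c (pi t)) (hc (pi t)) jc jc' => C C0 jc jc';
  do !case_le; solve [exfalso; lia | rewrite /=; ring].
Qed.

(** Both tails yield the same probability of zero influence. *)
Lemma tails_complement m : (m <= n)%N ->
  upper_tail m 0 + lower_tail m 1 = lower_tail m 0 + upper_tail m 1.
Proof.
move=> mn; rewrite /upper_tail /lower_tail -!expectD; apply: eq_expect => x.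
rewrite oppr0 -!natrD; congr _%:R; lia.
Qed.

Lemma upper_tail_anti m k : upper_tail m k.+1 <= upper_tail m k.
Proof. apply: le_expect => x; rewrite ler_nat; lia. Qed.

Lemma lower_tail_anti m k : lower_tail m k.+1 <= lower_tail m k.
Proof. apply: le_expect => x; rewrite ler_nat; lia. Qed.

Lemma tails0 k : upper_tail 0 k.+1 = 0 /\ lower_tail 0 k.+1 = 0.
Proof.
have infl0 x : influence_at 0 x = 0 by rewrite /influence_at big_pred0.
by split; apply: big1 => x _; rewrite infl0 ?oppr_ge0 mulr0.
Qed.

(** * Dominance of one tail over the other *)

Lemma upper_tail_dominates m k : (m <= n)%N -> 2%:R^-1 <= p ->
  p * lower_tail m k.+1 <= (1 - p) * upper_tail m k.+1.
Proof.
case/andP: hp => p0 p1; move=> mn p_half; elim: m mn k => [|m IHm] mn k.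
  by have [-> ->] := tails0 k; rewrite !mulr0.
rewrite (upper_tail_step (Ordinal mn)) (lower_tail_step (Ordinal mn)).
apply: tail_step_dominance => //; rewrite ?subr_ge0 //.
- by lra.
- exact: lower_tail_anti.
- exact: tails_complement (ltnW mn).
- by move=> j; exact: IHm (ltnW mn) j.
Qed.

Lemma lower_tail_dominates m k : (m <= n)%N -> p <= 2%:R^-1 ->
  (1 - p) * upper_tail m k.+1 <= p * lower_tail m k.+1.
Proof.
case/andP: hp => p0 p1; move=> mn p_half; elim: m mn k => [|m IHm] mn k.
  by have [-> ->] := tails0 k; rewrite !mulr0.
rewrite (upper_tail_step (Ordinal mn)) (lower_tail_step (Ordinal mn)).
(* The mirror case: here [F] is the lower tail, [G] the upper one, and [a] is [1 - p]. *)
apply: tail_step_dominance => //.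
- by lra.
- exact: upper_tail_anti.
- by rewrite (tails_complement (ltnW mn)).
- by move=> j; exact: IHm (ltnW mn) j.
Qed.

Lemma expect_accept_at t :
  expect t (accept_at t) = p +
    ((1 - p) * upper_tail t (c (pi t)) - p * lower_tail t (c (pi t))).
Proof.
(* The constant [p] becomes an expectation, so that the identity can be checked pointwise. *)
rewrite -[p in p + _]mulr1 -[X in p * X + _](expect1 (ltnW (ltn_ord t))) -mulNr.
rewrite /upper_tail /lower_tail -!expectZ -!expectD; apply: eq_expect => x.
rewrite /accept_at /accept_prob hq; move: (influence_at t x) (hc (pi t)) => I.
move: (c (pi t)) => C C0; do !case_le; solve [exfalso; lia | rewrite /=; ring].
Qed.

End Process.

Theorem theorem1 (R : realFieldType) (n : nat) (hn : (1 <= n)%N)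
    (c : 'I_n -> nat) (hc : forall v : 'I_n, (0 < c v)%N)
    (p : R) (hp : 0 <= p <= 1)
    (q : 'I_n -> R) (hq : forall v : 'I_n, q v = p)
    (pi : 'S_n) :
  (2%:R^-1 <= p -> n%:R * p <= expected_adopters c q pi) /\
  (p <= 2%:R^-1 -> expected_adopters c q pi <= n%:R * p).
Proof.
have -> : n%:R * p = \sum_(t < n) p by rewrite sumr_const card_ord mulr_natl.
rewrite expected_adoptersE; split=> p_half; apply: ler_sum => t _;
  (* Dominance holds only at positive indices, so the threshold is written as a successor. *)
  rewrite (expect_accept_at _ hc hq hp); rewrite -(prednK (hc (pi t))).
  rewrite lerDl subr_ge0.
  exact: (upper_tail_dominates _ hc hq hp _ (ltnW (ltn_ord t)) p_half).
rewrite gerDl subr_le0.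
exact: (lower_tail_dominates _ hc hq hp _ (ltnW (ltn_ord t)) p_half).
Qed.
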